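(* Let $X\in\mathbb{R}^{d\times d}$ be the matrix $$X=\sum_i\Big(\sum_{j\neq i}\alpha_{ij}(\mathbf{x}_i'-\mathbf{x}_j)+\sum_{j\neq i}\alpha_{ji}(\mathbf{x}_i-\mathbf{x}_j)\Big)\mathbf{x}_i^T-\sum_i(1-\alpha_{ii})(\mathbf{x}_i'-\mathbf{x}_i)\mathbf{x}_i'^T .$$ With $X$ fixed (constant in time) and with strong augmentation, such that $X$ has negative eigenvalues, the weight matrix $W=W(t)$, evolving by the gradient flow $\dot W=WX$, has vanishing singular values (that is, singular values of $W(t)$ that tend to $0$ as $t\to+\infty$).
   Context: Setting: a single-layer linear contrastive model with weight matrix $W\in\mathbb{R}^{m\times d}$ (the shape of $W$ is not otherwise specified). The inputs are vectors $\mathbf{x}_1,\dots,\mathbf{x}_N\in\mathbb{R}^d$ with augmented versions $\mathbf{x}_1',\dots,\mathbf{x}_N'\in\mathbb{R}^d$ (the augmentation is additive noise), and the embeddings are $\mathbf{z}_i=W\mathbf{x}_i$, $\mathbf{z}_i'=W\mathbf{x}_i'$. The model is trained by gradient flow (gradient descent with infinitesimally small learning rate) on the InfoNCE loss $$L=-\sum_{i=1}^N\log\frac{\exp(-|\mathbf{z}_i-\mathbf{z}_i'|^2/2)}{\sum_{j\ne i}\exp(-|\mathbf{z}_i-\mathbf{z}_j|^2/2)+\exp(-|\mathbf{z}_i-\mathbf{z}_i'|^2/2)},$$ and this flow has the form $\dot W=WX$. The coefficients are the softmax weights $\alpha_{ij}=\exp(-|\mathbf{z}_i-\mathbf{z}_j|^2/2)/Z_i$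 for $j\ne i$, $\alpha_{ii}=\exp(-|\mathbf{z}_i-\mathbf{z}_i'|^2/2)/Z_i$, with $Z_i=\sum_{j\ne i}\exp(-|\mathbf{z}_i-\mathbf{z}_j|^2/2)+\exp(-|\mathbf{z}_i-\mathbf{z}_i'|^2/2)$, so $\sum_j\alpha_{ij}=1$ for each $i$. The matrix $X$ is symmetric, being a difference of two positive semi-definite matrices: a weighted data covariance minus a weighted augmentation covariance. In this statement $X$ is held constant in time. *)

(* Defs.v *)
From HB Require Import structures.
From mathcomp Require Import all_boot all_order all_algebra.
From mathcomp Require Import polyrcf complex.
From mathcomp Require Import all_classical all_reals all_analysis.

Set Implicit Arguments.
Unset Strict Implicit.
Unset Printing Implicit Defensive.

Import Order.TTheory GRing.Theory Num.Theory.
Import numFieldNormedType.Exports.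

Local Open Scope ring_scope.
Local Open Scope classical_set_scope.

(* MathComp-Analysis norms ['cV_d] with the sup norm; this is |v|^2 for the
   Euclidean norm. *)
Definition sqnorm2 {R : realType} {d : nat} (v : 'cV[R]_d) : R :=
  \sum_(k < d) v k 0 ^+ 2.

(* V is the weight matrix at which the softmax weights are evaluated. *)
Section InfoNCE.
Context {R : realType} {N m d : nat}.
Variables (V : 'M[R]_(m, d)) (x x' : 'I_N -> 'cV[R]_d).

(* The diagonal entry is the similarity of the positive pair (z_i, z_i'). *)
Definition similarity (i j : 'I_N) : R :=
  if j == i then expR (- sqnorm2 (V *m x i - V *m x' i) / 2)
  else expR (- sqnorm2 (V *m x i - V *m x j) / 2).

Definition softmax_normalizer (i : 'I_N) : R :=
  \sum_(j < N | j != i) similarity i j + similarity i i.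

Definition alpha (i j : 'I_N) : R := similarity i j / softmax_normalizer i.

Definition flow_matrix : 'M[R]_d :=
  \sum_(i < N)
     (\sum_(j < N | j != i) alpha i j *: (x' i - x j)
      + \sum_(j < N | j != i) alpha j i *: (x i - x j)) *m (x i)^T
  - \sum_(i < N) (1 - alpha i i) *: ((x' i - x i) *m (x' i)^T).

End InfoNCE.

Definition gradient_flow {R : realType} {m d : nat}
    (W : R -> 'M[R]_(m, d)) (X : 'M[R]_d) : Prop :=
  {within `[0, +oo[, continuous W} /\
  (forall t : R, 0 < t -> is_derive t 1 W (W t *m X)).

(* The real eigenvalues in nondecreasing order, each repeated according to its
   algebraic multiplicity. *)
Definition eigenvalues {R : realType} {n : nat} (A : 'M[R]_n) : seq R :=
  flatten [seq nseq (mup l (char_poly A)) l | l <- rootsR (char_poly A)].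

Lemma eigenvalues_perm {R : realType} {n : nat} (A : 'M[R]_n) (s : seq R) :
  char_poly A = \prod_(l <- s) ('X - l%:P) -> perm_eq (eigenvalues A) s.
Proof.
move=> As; have pN0 := monic_neq0 (char_poly_monic A).
apply/allP => l _ /=; apply/eqP; rewrite /eigenvalues count_flatten -!map_comp.
transitivity (mup l (char_poly A)); last by rewrite As mu_prod_XsubC.
rewrite sumnE big_map.
under eq_bigr do rewrite /= count_nseq /=.
have := roots_on_rootsR pN0 l; rewrite in_itv /= => rl.
have urs : uniq (rootsR (char_poly A)) by apply: lt_sorted_uniq; apply: sorted_roots.
have [lr|lr] := boolP (l \in rootsR (char_poly A)).
  rewrite (bigD1_seq l) //= eqxx mul1n big1 ?addn0 // => i /negPf il.
  by rewrite il.
rewrite mupNroot ?rl // big_seq big1 // => i ir.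
by case: eqP => // il; rewrite -il ir in lr.
Qed.

Lemma char_poly_symmetric {R : realType} {n : nat} (A : 'M[R]_n) :
  A^T = A -> exists s : seq R, char_poly A = \prod_(l <- s) ('X - l%:P).
Proof.
move=> AT; pose f := real_complex R; pose B := map_mx f A.
have Bh : B \is hermsymmx.
  apply/is_hermitianmxP; rewrite expr0 scale1r; apply/matrixP => i j.
  rewrite !mxE -{1}AT mxE; apply/esym/CrealP/complex_realP.
  by exists (A j i).
have Dr := hermitian_spectral_diag_real Bh.
have /orthomx_spectralP := hermitian_normalmx Bh.
set P := spectralmx B; set D := spectral_diag B => BE.
have PU : P \in unitmx := spectral_unit B.
exists [seq complex.Re (D 0 i) | i <- enum 'I_n].
apply: (map_poly_inj (real_complex R)); rewrite -[RHS]/(map_poly f _) -[LHS]/(map_poly f _).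
have -> : map_poly f (char_poly A) = char_poly B by exact: (map_char_poly f A).
rewrite big_map big_enum rmorph_prod /=.
transitivity (char_poly (diag_mx D)).
  rewrite BE /char_poly /char_poly_mx !map_mxM.
  have -> : 'X%:M - map_mx polyC (invmx P) *m map_mx polyC (diag_mx D) *m map_mx polyC P
     = map_mx polyC (invmx P) *m char_poly_mx (diag_mx D) *m map_mx polyC P.
    rewrite /char_poly_mx mulmxBr mulmxBl mul_mx_scalar -scalemxAl -(map_mxM polyC (invmx P) P).
    by rewrite mulVmx // map_mx1 scalemx1.
  rewrite !det_mulmx mulrC mulrA -det_mulmx -(map_mxM polyC P (invmx P)) mulmxV //.
  by rewrite map_mx1 det1 mul1r.
rewrite char_poly_trig ?diag_mx_is_trig //; apply: eq_bigr => i _.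
rewrite rmorphB /= map_polyX map_polyC /= mxE eqxx mulr1n.
have /mxOverP/(_ 0 i)/complex_realP[r ->] := Dr.
by [].
Qed.

Lemma size_eigenvalues {R : realType} {n : nat} (A : 'M[R]_n) :
  A^T = A -> size (eigenvalues A) = n.
Proof.
move=> /char_poly_symmetric[s As].
rewrite (perm_size (eigenvalues_perm As)); apply: succn_inj.
by rewrite -(size_char_poly A) As size_prod_XsubC.
Qed.

(* The square roots of the eigenvalues of W^T W, in nonincreasing order: there
   are n of them (size_singular_values), so if m < n the last n - m vanish
   identically. *)
Definition singular_values {R : realType} {m n : nat} (W : 'M[R]_(m, n)) :
  seq R := rev [seq Num.sqrt l | l <- eigenvalues (W^T *m W)].

Lemma size_singular_values {R : realType} {m n : nat} (W : 'M[R]_(m, n)) :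
  size (singular_values W) = n.
Proof.
by rewrite size_rev size_map size_eigenvalues // trmx_mul trmxK.
Qed.

(* Main.v *)
(* Since the softmax weights of each row sum to 1, X is symmetric. If u is an
   eigenvector of X for l, then W u solves the scalar equation y' = l y, so
   W(t) u = exp(l (t - 1)) W(1) u. Hence |W(t) u|^2 <= h(t)^2 |u|^2 with
   h(t) -> 0, uniformly on the k-dimensional sum of the eigenspaces of X for
   negative eigenvalues, and by the Courant-Fischer principle at least k
   eigenvalues of W(t)^T W(t) are at most h(t)^2. The spectral theorem is used
   over R[i]; as the eigenvalues are real, the differential equation can be
   solved on the real and imaginary parts of an eigenvector. *)
Require Import Defs.
From mathcomp Require Import all_boot all_order all_algebra.
From mathcomp Require Import polyrcf complex zify ring.
From mathcomp Require Import all_classical all_reals all_analysis.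

Set Implicit Arguments.
Unset Strict Implicit.
Unset Printing Implicit Defensive.

Import Order.TTheory GRing.Theory Num.Theory.
Import numFieldNormedType.Exports.

Local Open Scope ring_scope.
Local Open Scope classical_set_scope.
Local Open Scope sesquilinear_scope.

(** * Hermitian forms and eigenvalue counts over a closed field *)

Lemma mulmx_trmxC_diag (C : numClosedFieldType) n (v D : 'rV[C]_n) :
  (v *m diag_mx D *m v ^t*) 0 0 = \sum_j D 0 j * `|v 0 j| ^+ 2.
Proof.
rewrite mul_mx_diag mxE; apply: eq_bigr => j _.
by rewrite !mxE normCK mulrAC mulrC.
Qed.

Lemma mulmx_trmxC (C : numClosedFieldType) n (v : 'rV[C]_n) :
  (v *m v ^t*) 0 0 = \sum_j `|v 0 j| ^+ 2.
Proof. by rewrite mxE; apply: eq_bigr => j _; rewrite !mxE normCK. Qed.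

(** Each coordinate of [c] is at most the norm of [c], so the j-th coordinate of [c *m B] is at most
    the j-th column sum of moduli times that norm. The constant is crude, but it tends to 0 with the
    entries of [B]. *)
Lemma mulmx_trmxC_le (C : numClosedFieldType) k m (c : 'rV[C]_k)
    (B : 'M[C]_(k, m)) :
  ((c *m B) *m (c *m B) ^t*) 0 0
    <= (\sum_j \sum_i `|B i j|) ^+ 2 * (c *m c ^t*) 0 0.
Proof.
rewrite !mulmx_trmxC.
set s := \sum_(i < k) _; pose b j := \sum_i `|B i j|.
rewrite -[\sum_j _]/(\sum_j b j).
have s0 : 0 <= s by apply: sumr_ge0 => i _; rewrite exprn_ge0.
have b0 j : 0 <= b j by apply: sumr_ge0.
have cs i : `|c 0 i| <= sqrtC s.
  rewrite -(@ler_pXn2r _ 2) ?nnegrE ?sqrtC_ge0 ?normr_ge0 // sqrtCK /s.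
  rewrite (bigD1 i) //= lerDl; apply: sumr_ge0 => ? _.
  by rewrite exprn_ge0.
apply: (@le_trans _ _ (\sum_j b j * (\sum_j b j) * s)); last first.
  by rewrite -!mulr_suml expr2.
apply: ler_sum => j _; apply: (@le_trans _ _ (b j ^+ 2 * s)); last first.
  apply: ler_wpM2r => //; rewrite expr2; apply: ler_wpM2l => //.
  by rewrite (bigD1 j) //= lerDl sumr_ge0.
rewrite -[s]sqrtCK -exprMn.
apply: lerXn2r; rewrite ?nnegrE ?mulr_ge0 ?sqrtC_ge0 //.
rewrite mxE (le_trans (ler_norm_sum _ _ _)) // mulr_suml.
by apply: ler_sum => i _; rewrite normrM mulrC ler_wpM2l.
Qed.

Lemma char_poly_normal (C : numClosedFieldType) n (A : 'M[C]_n) :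
  A \is normalmx ->
  char_poly A = \prod_i ('X - (spectral_diag A 0 i)%:P).
Proof.
move=> /orthomx_spectralP.
set P := spectralmx A; set D := spectral_diag A => AE.
have PU : P \in unitmx := spectral_unit A.
rewrite AE.
transitivity (char_poly (diag_mx D)); last first.
  rewrite char_poly_trig ?diag_mx_is_trig //; apply: eq_bigr => i _.
  by rewrite mxE eqxx mulr1n.
pose Q := map_mx polyC P; have QU : Q \in unitmx by rewrite map_unitmx.
rewrite /char_poly; have -> : char_poly_mx (invmx P *m diag_mx D *m P)
    = invmx Q *m char_poly_mx (diag_mx D) *m Q.
  rewrite /char_poly_mx mulmxBr mulmxBl mul_mx_scalar -scalemxAl mulVmx //.
  by rewrite scalemx1 !map_mxM map_invmx.
by rewrite !det_mulmx mulrAC -det_mulmx mulVmx // det1 mul1r.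
Qed.

Lemma unitarymx_isometry (C : numClosedFieldType) p k n (v : 'M[C]_(p, k))
    (U : 'M[C]_(k, n)) :
  U \is unitarymx -> (v *m U) *m (v *m U) ^t* = v *m v ^t*.
Proof. by move=> Uu; rewrite trmx_mul map_mxM mulmxA mulmxtVK. Qed.

(* One half of the Courant-Fischer principle: fewer than k eigenvalues at most e
   would leave a nonzero vector in the row space of U whose coordinates along
   the corresponding eigenvectors all vanish. *)
Lemma card_spectral_diag_le (C : numClosedFieldType) k n (A : 'M[C]_n)
    (U : 'M[C]_(k, n)) (e : C) :
  A \is hermsymmx -> U \is unitarymx -> e \is Num.real ->
  (forall c : 'rV_k,
    (c *m U *m A *m (c *m U) ^t*) 0 0 <= e * (c *m c ^t*) 0 0) ->
  (k <= #|[pred j | (spectral_diag A 0 j <= e)%R]|)%N.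
Proof.
move=> Ah Uu er UA; rewrite leqNgt; apply/negP => Tk.
have Dr := hermitian_spectral_diag_real Ah.
have /orthomx_spectralP := hermitian_normalmx Ah.
have Pu := spectral_unitarymx A.
move: Tk Dr; rewrite (invmx_unitary Pu).
set P := spectralmx A in Pu *; set D := spectral_diag A => Tk Dr AE.
set T := [pred j | _] in Tk.
(* Row i of [M] holds the coordinates of row i of [U] in the eigenbasis [P]. [MT] keeps the fewer
   than k columns indexed by [T], so its left kernel is nonzero. *)
pose M := U *m P^t*.
pose MT := colsub (fun j : 'I_#|T| => enum_val j) M.
have /rowV0Pn[c /sub_kermxP cM c0] : kermx MT != 0.
  rewrite kermx_eq0 -row_leq_rank -ltnNge.
  exact: leq_ltn_trans (rank_leq_col _) Tk.
pose y := c *m M.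
have yP : c *m U = y *m P by rewrite /y /M mulmxA mulmxKtV.
have yT j : T j -> y 0 j = 0.
  move=> Tj; have /matrixP/(_ 0 (enum_rank_in Tj j)) := cM.
  rewrite [RHS]mxE => <-; rewrite [LHS]mxE [RHS]mxE; apply: eq_bigr => i _.
  by rewrite [in RHS]mxE enum_rankK_in.
have yc : y *m y^t* = c *m c^t*.
  by rewrite -(unitarymx_isometry _ Pu) -yP unitarymx_isometry.
have y0 : y != 0.
  apply: contraNneq c0 => y0; rewrite -[c](mulmxtVK _ Uu) yP y0.
  by rewrite !mul0mx.
have [j yj] : exists j, y 0 j != 0 by apply/rV0Pn.
have := UA c; rewrite {}yP AE -yc mulmxA.
rewrite !mulmxA mulmxtVK // trmx_mul map_mxM mulmxA mulmxtVK //.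
rewrite mulmx_trmxC_diag mulmx_trmxC mulr_sumr -subr_ge0 -sumrB.
apply/negP; rewrite -real_ltNge ?real0 //; last first.
  apply: sum_real => i _; rewrite realB // realM // ?realX ?normr_real //.
  exact: (mxOverP Dr).
(* Coordinates in [T] vanish and any other nonzero one contributes a negative term; the coordinate
   [j] makes the sum strictly negative. *)
have term i : e * `|y 0 i| ^+ 2 - D 0 i * `|y 0 i| ^+ 2 <= 0
    ?= iff (y 0 i == 0).
  rewrite -mulrBl; have [->|yi] := eqVneq (y 0 i) 0.
    by rewrite normr0 expr0n /= mulr0; split; rewrite ?eqxx.
  have DS : e < D 0 i.
    rewrite real_ltNge ?(mxOverP Dr) //; apply: contra_neqN yi; exact: yT.
  have lt0 : (e - D 0 i) * `|y 0 i| ^+ 2 < 0.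
    by rewrite nmulr_rlt0 ?subr_lt0 // exprn_gt0 // normr_gt0.
  by split; [exact: ltW|rewrite lt_eqF].
rewrite (bigD1 j) //= -[ltRHS]addr0 ltr_leD //.
  by rewrite lt_neqAle !term (negPf yj).
by apply: sumr_le0 => i _; rewrite term.
Qed.

(** * The flow along a real eigenvector *)

(* Starting from time 1 rather than 0 makes continuity of y at 0 unnecessary. *)
Lemma linear_ode_exp (R : realType) (l : R) (y : R -> R) :
  (forall t : R, 0 < t -> is_derive t 1 y (l * y t)) ->
  forall t : R, 1 <= t -> y t = expR (l * (t - 1)) * y 1.
Proof.
(* The integrating factor gives [z] derivative 0, and it is normalized so that [z 1 = y 1]. *)
move=> dy t t1; pose z u := expR (- l * (u - 1)) * y u.
have dz (u : R) : 0 < u -> is_derive u 1 z 0.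
  move=> /dy dyu.
  have de : is_derive u 1 (fun v : R => expR (- l * (v - 1)))
      (expR (- l * (u - 1)) * - l).
    have dg : is_derive u 1 (fun v : R => - l * (v - 1)) (- l).
      have -> : (fun v : R => - l * (v - 1)) = - l \*: (id - cst 1).
        by apply/funext.
      by apply: is_derive_eq; rewrite subr0 /GRing.scale /= mulr1.
    exact: (@is_derive1_comp R expR).
  suff <- : expR (- l * (u - 1)) *: (l * y u)
      + y u *: (expR (- l * (u - 1)) * - l) = 0 by exact: is_deriveM.
  by rewrite /GRing.scale /=; ring.
have [| |c _] := MVT_segment (df := fun=> 0) t1 (f := z).
- move=> u; rewrite in_itv /= => /andP[u1 _]; apply: dz; exact: lt_trans u1.
- apply: derivable_within_continuous => u; rewrite in_itv /= => /andP[u1 _].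
  by have [] := dz u (lt_le_trans ltr01 u1).
rewrite mul0r => /subr0_eq; rewrite /z subrr mulr0 expR0 mul1r => <-.
by rewrite mulrA -expRD mulNr subrr expR0 mul1r.
Qed.

(** By symmetry of [X], [a *m (W t)^T] has derivative [a *m X *m (W t)^T], so each coordinate solves
    the scalar equation. Row vectors are used to match the rows of [spectralmx]. *)
Lemma gradient_flow_eigenvector (R : realType) m d (W : R -> 'M[R]_(m, d))
    (X : 'M[R]_d) (a : 'rV[R]_d) (l : R) :
  gradient_flow W X -> X^T = X -> a *m X = l *: a ->
  forall t : R, 1 <= t -> a *m (W t)^T = expR (l * (t - 1)) *: (a *m (W 1)^T).
Proof.
move=> [_ dW] XT aX t t1; apply/rowP => i; rewrite [RHS]mxE.
apply: (@linear_ode_exp R l (fun t => (a *m (W t)^T) 0 i)) => // u u0.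
have [Wu WuE] := dW _ u0.
have dWij j : is_derive u 1 (fun t => W t i j) ((W u *m X) i j).
  split; first by move/derivable_mxP: Wu.
  by rewrite -WuE derive_mx // mxE.
have -> : (fun t => (a *m (W t)^T) 0 i) = \sum_j (fun t => a 0 j * W t i j).
  apply/funext => v; rewrite mxE fct_sumE; apply: eq_bigr => j _.
  by rewrite mxE.
suff <- : \sum_j a 0 j *: (W u *m X) i j = l * (a *m (W u)^T) 0 i.
  by apply: is_derive_sum => j; exact: is_deriveZ.
transitivity ((a *m (W u *m X)^T) 0 i).
  by rewrite mxE; apply: eq_bigr => j _; rewrite [in RHS]mxE.
by rewrite trmx_mul XT mulmxA aX -scalemxAl mxE.
Qed.

(** * Symmetry of the flow matrix *)

Lemma sum_alpha (R : realType) N m d (V : 'M[R]_(m, d))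
    (x x' : 'I_N -> 'cV[R]_d) i :
  \sum_(j < N | j != i) alpha V x x' i j = 1 - alpha V x x' i i.
Proof.
have sim_gt0 j : 0 < similarity V x x' i j.
  by rewrite /similarity; case: ifP => _; exact: expR_gt0.
rewrite /alpha -mulr_suml; apply/eqP; rewrite eq_sym subr_eq -mulrDl divff //.
by rewrite gt_eqF // ltr_wpDl // sumr_ge0 // => j _; exact: ltW.
Qed.

(** By [sum_alpha], [x' i *m (x i)^T] and [x i *m (x' i)^T] both get the coefficient [1 - al i i].
    What remains is a combination of squares [v *m v^T], minus a double sum with weights symmetric
    in i and j. *)
Lemma trmx_flow_matrix (R : realType) N m d (V : 'M[R]_(m, d))
    (x x' : 'I_N -> 'cV[R]_d) :
  (flow_matrix V x x')^T = flow_matrix V x x'.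
Proof.
pose al := alpha V x x'.
pose s (i : 'I_N) a b :=
  (1 - al i i)
    * (x' i a 0 * x i b 0 + x i a 0 * x' i b 0 - x' i a 0 * x' i b 0)
  + (\sum_(j < N | j != i) al j i) * (x i a 0 * x i b 0).
have entry (w : 'I_N -> R) (u : 'cV[R]_d) i a :
    (\sum_(j < N | j != i) w j *: (u - x j)) a 0 =
    (\sum_(j < N | j != i) w j) * u a 0 - \sum_(j < N | j != i) w j * x j a 0.
  rewrite summxE mulr_suml -sumrB; apply: eq_bigr => j _.
  by rewrite !mxE mulrBr.
have E a b : flow_matrix V x x' a b = \sum_(i < N) s i a b
    - \sum_(i < N) \sum_(j < N | j != i)
        (al i j + al j i) * (x j a 0 * x i b 0).
  rewrite /flow_matrix [LHS]mxE [X in _ + X]mxE !summxE -!sumrB.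
  apply: eq_bigr => i _; rewrite [X in X - _]mxE big_ord1 [X in X * _]mxE !entry.
  have -> : \sum_(j < N | j != i) (al i j + al j i) * (x j a 0 * x i b 0) =
      (\sum_(j < N | j != i) al i j * x j a 0
       + \sum_(j < N | j != i) al j i * x j a 0) * x i b 0.
    rewrite -big_split mulr_suml; apply: eq_bigr => j _; rewrite /=; ring.
  by rewrite /s sum_alpha !mxE big_ord1 !mxE -/al; ring.
apply/matrixP => a b; rewrite mxE !E; congr (_ - _).
  by apply: eq_bigr => i _; rewrite /s; ring.
(* Transposing the double sum amounts to swapping i and j. *)
rewrite (exchange_big_dep predT) //=; apply: eq_bigr => i _.
apply: eq_big => j; first by rewrite eq_sym.
by move=> _; ring.
Qed.

(** * Real eigenvalues read off the complex spectral theorem *)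

Lemma sorted_eigenvalues (R : realType) n (A : 'M[R]_n) :
  sorted <=%O (eigenvalues A).
Proof.
rewrite /eigenvalues; set p := char_poly A.
have : sorted <%O (rootsR p) by exact: sorted_roots.
elim: (rootsR p) => [//|l r IH] /= lr.
have /allP lt_lr := order_path_min lt_trans lr.
rewrite (sorted_pairwise le_trans) pairwise_cat.
have := IH (path_sorted lr); rewrite (sorted_pairwise le_trans) => ->.
rewrite andbT; apply/andP; split.
  apply/allrelP => u v /nseqP[-> _] /flattenP[_ /mapP[w wr ->]] /nseqP[-> _].
  exact/ltW/lt_lr.
by elim: (mup l p) => //= k ->; rewrite andbT; apply/allP => u /nseqP[->].
Qed.

Lemma hermsymmx_real_complex (R : realType) n (A : 'M[R]_n) :
  A^T = A -> map_mx (real_complex R) A \is hermsymmx.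
Proof.
move=> AT; apply/is_hermitianmxP; rewrite expr0 scale1r; apply/matrixP => i j.
rewrite !mxE -{1}AT mxE; apply/esym/CrealP/complex_realP.
by exists (A j i).
Qed.

(** Both lists are the roots, with multiplicity, of the same characteristic polynomial; the
    factorization over R is checked after the injective embedding into [R[i]]. *)
Lemma count_eigenvalues (R : realType) n (A : 'M[R]_n) (a : pred R) : A^T = A ->
  count a (eigenvalues A) =
  #|[pred j | a (complex.Re (spectral_diag (map_mx (real_complex R) A) 0 j))]|.
Proof.
move=> AT; have Ah := hermsymmx_real_complex AT.
have Dr := mxOverP (hermitian_spectral_diag_real Ah).
set D := spectral_diag _ in Dr *.
pose s := [seq complex.Re (D 0 j) | j <- enum 'I_n].
rewrite (permP (@eigenvalues_perm R n A s _)).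
  by rewrite count_map -sum1_count big_enum_cond /= -sum1_card; apply: eq_bigl.
apply: (map_poly_inj (real_complex R)).
rewrite -[RHS]/(map_poly (real_complex R) _).
have -> := map_char_poly (real_complex R) A.
rewrite char_poly_normal ?hermitian_normalmx // big_map big_enum rmorph_prod /=.
apply: eq_bigr => j _; rewrite rmorphB /= map_polyX map_polyC /=.
by rewrite -[D 0 j in LHS]RRe_real.
Qed.

Lemma mem_eigenvalues (R : realType) n (A : 'M[R]_n) l : A^T = A ->
  (l \in eigenvalues A) = eigenvalue A l.
Proof.
move=> /char_poly_symmetric[s As].
rewrite (perm_mem (eigenvalues_perm As)) eigenvalue_root_char As.
by rewrite root_prod_XsubC.
Qed.

(** * The flow along a complex eigenvector *)

Lemma map_Re_mulmx (R : realType) m n p (u : 'M[R[i]]_(m, n))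
    (M : 'M[R]_(n, p)) :
  map_mx (@complex.Re R) (u *m map_mx (real_complex R) M)
    = map_mx (@complex.Re R) u *m M.
Proof.
have ReD : {morph @complex.Re R : a b / a + b} by case=> ? ? [].
apply/matrixP => i j; rewrite !mxE (big_morph _ ReD (id1 := 0)) //.
apply: eq_bigr => k _; rewrite !mxE; case: (u i k) => a b /=.
by rewrite mulr0 subr0.
Qed.

Lemma map_Im_mulmx (R : realType) m n p (u : 'M[R[i]]_(m, n))
    (M : 'M[R]_(n, p)) :
  map_mx (@complex.Im R) (u *m map_mx (real_complex R) M)
    = map_mx (@complex.Im R) u *m M.
Proof.
have ImD : {morph @complex.Im R : a b / a + b} by case=> ? ? [].
apply/matrixP => i j; rewrite !mxE (big_morph _ ImD (id1 := 0)) //.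
apply: eq_bigr => k _; rewrite !mxE; case: (u i k) => a b /=.
by rewrite mulr0 add0r.
Qed.

Lemma gradient_flow_complex_eigenvector (R : realType) m d
    (W : R -> 'M[R]_(m, d)) (X : 'M[R]_d) (u : 'rV[R[i]]_d) (l : R) :
  gradient_flow W X -> X^T = X ->
  u *m map_mx (real_complex R) X = real_complex R l *: u ->
  forall t : R, 1 <= t -> u *m map_mx (real_complex R) (W t)^T
    = real_complex R (expR (l * (t - 1)))
        *: (u *m map_mx (real_complex R) (W 1)^T).
Proof.
move=> gW XT uX t t1.
have Zr r n (v : 'rV[R[i]]_n) :
   map_mx (@complex.Re R) (real_complex R r *: v)
     = r *: map_mx (@complex.Re R) v.
  apply/rowP => i; rewrite !mxE; case: (v 0 i) => a b /=.
  by rewrite mul0r subr0.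
have Zi r n (v : 'rV[R[i]]_n) :
   map_mx (@complex.Im R) (real_complex R r *: v)
     = r *: map_mx (@complex.Im R) v.
  apply/rowP => i; rewrite !mxE; case: (v 0 i) => a b /=.
  by rewrite mul0r addr0.
have ur : map_mx (@complex.Re R) u *m X = l *: map_mx (@complex.Re R) u.
  by rewrite -map_Re_mulmx uX Zr.
have ui : map_mx (@complex.Im R) u *m X = l *: map_mx (@complex.Im R) u.
  by rewrite -map_Im_mulmx uX Zi.
have /rowP Er := gradient_flow_eigenvector gW XT ur t1.
have /rowP Ei := gradient_flow_eigenvector gW XT ui t1.
rewrite -!map_Re_mulmx -Zr in Er; rewrite -!map_Im_mulmx -Zi in Ei.
apply/rowP => i; apply/eqP; rewrite eq_complex.
by have := Er i; have := Ei i; rewrite !mxE => -> ->; rewrite !eqxx.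
Qed.

(** * Decay of eigenvalues and singular values *)

Lemma cvg_expR_neg (R : realType) (l : R) : l < 0 ->
  expR (l * (t - 1)) @[t --> +oo] --> (0 : R).
Proof.
move=> l0.
have -> : (fun t => expR (l * (t - 1)))
    = (fun x => expR (- x)) \o (fun t => - l * (t - 1)).
  by apply/funext => t /=; rewrite mulNr opprK.
apply: cvg_comp; last exact: cvgr_expR.
apply/cvgryPge => A; near=> t.
rewrite mulrC -ler_pdivrMr ?oppr_gt0 // lerBrDr.
by near: t; apply: nbhs_pinfty_ge; rewrite num_real.
Unshelve. all: by end_near. Qed.

Lemma gradient_flow_eigenvalues_decay (R : realType) m d (W : R -> 'M[R]_(m, d))
    (X : 'M[R]_d) :
  gradient_flow W X -> X^T = X ->
  exists2 h : R -> R, h t @[t --> +oo] --> (0 : R) &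
  forall t : R, 1 <= t ->
    (count (fun l => (l < 0)%R) (eigenvalues X)
      <= count (<= h t ^+ 2) (eigenvalues ((W t)^T *m W t)))%N.
Proof.
move=> gW XT; pose f := real_complex R.
have Xh := hermsymmx_real_complex XT.
have Dr := mxOverP (hermitian_spectral_diag_real Xh).
have Pu := spectral_unitarymx (map_mx f X).
have /orthomx_spectralP := hermitian_normalmx Xh.
rewrite count_eigenvalues //; move: Dr Pu; rewrite -/f.
set P := spectralmx _; set D := spectral_diag _ => Dr Pu XE.
set K := [pred j | _].
pose lam (i : 'I_#|K|) := complex.Re (D 0 (enum_val i)).
have lam0 i : lam i < 0 by have := enum_valP i.
(* The rows of [U] are orthonormal eigenvectors of [X] for its negative eigenvalues. *)
pose U := rowsub (fun i : 'I_#|K| => enum_val i) P.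
have rowU i : row i U = row (enum_val i) P by rewrite row_rowsub.
have Uu : U \is unitarymx.
  apply/row_unitarymxP => i j; rewrite !rowU (row_unitarymxP Pu).
  by rewrite (inj_eq enum_val_inj).
have UX i : row i U *m map_mx f X = f (lam i) *: row i U.
  rewrite rowU XE -row_mul !mulmxA mulmxV ?spectral_unit // mul1mx.
  by apply/rowP => j; rewrite mul_diag_mx !mxE /f /lam RRe_real.
pose B t := U *m map_mx f (W t)^T.
have BE t : 1 <= t ->
    forall i j, B t i j = f (expR (lam i * (t - 1))) * B 1 i j.
  move=> t1 i j.
  have /rowP/(_ j) := gradient_flow_complex_eigenvector gW XT (UX i) t1.
  by rewrite -!row_mul !mxE.
(* For [t >= 1] this is the sum of the moduli of the entries of [B t], the constant of
   [mulmx_trmxC_le]; the exponentials show its limit term by term. *)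
exists (fun t => \sum_j \sum_i expR (lam i * (t - 1)) * complex.Re `|B 1 i j|).
  have c0 (r : R) i : expR (lam i * (t - 1)) * r @[t --> +oo] --> 0 * r.
    by apply: cvgMr_tmp; exact: cvg_expR_neg.
  have c1 j : \sum_i expR (lam i * (t - 1)) * complex.Re `|B 1 i j| @[t --> +oo]
      --> \sum_i 0 * complex.Re `|B 1 i j|.
    by apply: (@cvg_big R _ +%R 0 xpredT (@add_continuous R)) => i _; exact: c0.
  suff : \sum_j \sum_i expR (lam i * (t - 1)) * complex.Re `|B 1 i j|
      @[t --> +oo] --> \sum_(j < m) \sum_i 0 * complex.Re `|B 1 i j|.
    rewrite [X in _ --> X -> _]big1 // => j _.
    by rewrite big1 // => i _; rewrite mul0r.
  by apply: (@cvg_big R _ +%R 0 xpredT (@add_continuous R)) => j _; exact: c1.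
move=> t t1; set h := \sum_j _.
have hE : f h = \sum_j \sum_i `|B t i j|.
  rewrite /f /h rmorph_sum; apply: eq_bigr => j _; rewrite rmorph_sum.
  apply: eq_bigr => i _; rewrite (BE t) // normrM ger0_norm ?ler0c ?expR_ge0 //.
  by rewrite rmorphM; congr (_ * _); exact: RRe_real (normr_real _).
have AT : ((W t)^T *m W t)^T = (W t)^T *m W t by rewrite trmx_mul trmxK.
have Ah := hermsymmx_real_complex AT.
have Ar := mxOverP (hermitian_spectral_diag_real Ah).
rewrite count_eigenvalues //.
have := @card_spectral_diag_le _ _ _ _ U (f (h ^+ 2)) Ah Uu.
move=> /(_ _ _)/leq_trans; apply.
- by apply/complex_realP; exists (h ^+ 2).
- move=> c; have -> : f (h ^+ 2) = f h ^+ 2 by exact: rmorphXn.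
  rewrite hE.
  (* Since [W t] is real, the squared norm of [c *m B t] is the quadratic form of [(W t)^T *m W t]
     at [c *m U]. *)
  have := mulmx_trmxC_le c (B t); congr (_ <= _).
  rewrite /B mulmxA [(c *m U *m _)^T]trmx_mul map_mxM mulmxA.
  congr (fun_of_matrix (_ *m _) _ _).
  rewrite (map_mxM f) -!mulmxA; congr (_ *m (_ *m (_ *m _))).
  by apply/matrixP => i j; rewrite !mxE; exact: conjc_real.
apply: eq_leq; apply: eq_card => j; rewrite !inE.
by rewrite -{1}(RRe_real (Ar 0 j)) lecR.
Qed.

Unset Implicit Arguments.

Theorem theorem1 (R : realType) (N m d : nat) (x x' : 'I_N -> 'cV[R]_d)
    (V : 'M[R]_(m, d)) (W : R -> 'M[R]_(m, d)) :
  let X := flow_matrix V x x' in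
  let k := count (fun l => l < 0) (eigenvalues X) in
  (exists2 l : R, eigenvalue X l & l < 0) ->
  gradient_flow W X ->
  (0 < k)%N /\
  forall i : nat, (d - k <= i < d)%N ->
    (singular_values (W t))`_i @[t --> +oo] --> (0 : R).
Proof.
move=> X k [l lX l0] gW; have XT : X^T = X := trmx_flow_matrix V x x'.
split.
  by rewrite -has_count; apply/hasP; exists l; rewrite ?mem_eigenvalues.
move=> i /andP[ki id].
have [h h0 hW] := gradient_flow_eigenvalues_decay gW XT.
(* The absolute value arises as the square root of [h t ^+ 2]. *)
apply: (@squeeze_cvgr _ _ _ _ (fun=> 0) (fun t => `|h t|)).
- near=> t.
  have t1 : 1 <= t by near: t; apply: nbhs_pinfty_ge; rewrite num_real.
  have size_ev : size (eigenvalues ((W t)^T *m W t)) = d.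
    by rewrite size_eigenvalues // trmx_mul trmxK.
  (* Position [i] from the top is position [d - i.+1] from the bottom, which is below k; at least k
     of the sorted eigenvalues are at most [h t ^+ 2]. *)
  rewrite /singular_values nth_rev size_map size_ev //.
  have id' : (d - i.+1 < d)%N by lia.
  rewrite (nth_map 0) ?size_ev // sqrtr_ge0 /= -sqrtr_sqr ler_wsqrtr //.
  apply: nth_count_le; first exact: sorted_eigenvalues.
  apply: leq_trans (hW t t1); rewrite -/k; lia.
- exact: cvg_cst.
- by rewrite -(normr0 R); exact: cvg_norm.
Unshelve. all: by end_near. Qed.
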